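(* Let $\mathcal{R}^{rsc}$ be a rich single-crossing domain and $F:\mathcal{R}^{rsc}\to\mathbb{Z}$ a mechanism that is monotone with $V^F$ continuous. Suppose the range $Rn(F)$ is countable, closed in $\mathbb{Z}$, and has finitely many limit points. Then $F$ is strategy-proof.
   Context: $\mathbb{Z}=[0,\infty)\times[0,1]$ (Euclidean topology); $(t',q')<(t'',q'')$ means $t'<t''$, $q'<q''$; $x\le y$ means $x=y$ or $x<y$; $\square(z)=\{x:x\le z\}$. A classical preference is a complete transitive relation $R$ on $\mathbb{Z}$ (strict part $P$, indifference $I$) strictly decreasing in $t$ for fixed $q$, strictly increasing in $q$ for fixed $t$, with closed upper and lower contour sets. Distinct classical preferences satisfy single-crossing if any indifference set of one meets any indifference set of the other in at most one point. A rich single-crossing domain $\mathcal{R}^{rsc}$ is a set of pairwise single-crossing classical preferences such that for all $x'<x''$ some member is indifferent between them. For distinct members, $R'\prec R''$ means $\square(z)\cap\{x:xR''z\}\subseteq\square(z)\cap\{x:xR'z\}$ for all $z$; $\prec$ is a linear order; order topology. $F$ is strategy-proof if $F(R')R'F(R'')$ for all $R',R''$; monotone if $R'\prec R''$ implies $F(R')\le F(R'')$. $V^F(R)=\{z:zIF(R)\}$ is continuous if for every $R$ and every monotone sequence $R^n\to R$ ($R^n\precsim R^{n+1}$ for all $n$, or $R^{n+1}\precsim R^n$ for all $n$), $F(R^n)$ converges and $\lim F(R^n)\,I\,F(R)$. *)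

(* Defs.v *)
From Stdlib Require Import Reals List.
From Coquelicot Require Import Coquelicot.
Open Scope R_scope.

(** Points of R^2: (t, q). *)
Definition pt := (R * R)%type.

Definition inZ (x : pt) : Prop := 0 <= fst x /\ 0 <= snd x <= 1.

Definition lt_pt (x y : pt) : Prop := fst x < fst y /\ snd x < snd y.
Definition le_pt (x y : pt) : Prop := x = y \/ lt_pt x y.

Definition closed_in_Z (A : pt -> Prop) : Prop :=
  exists C : pt -> Prop, closed C /\ forall x, inZ x -> (A x <-> C x).

(** A preference is a binary relation on points (only its restriction to Z matters). *)
Definition pref := pt -> pt -> Prop.

Definition strict (Rl : pref) (x y : pt) : Prop := Rl x y /\ ~ Rl y x.
Definition indiff (Rl : pref) (x y : pt) : Prop := Rl x y /\ Rl y x.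

Definition classical (Rl : pref) : Prop :=
  (forall x y, inZ x -> inZ y -> Rl x y \/ Rl y x) /\
  (forall x y z, inZ x -> inZ y -> inZ z -> Rl x y -> Rl y z -> Rl x z) /\
  (forall t1 t2 q, inZ (t1, q) -> inZ (t2, q) -> t1 < t2 -> strict Rl (t1, q) (t2, q)) /\
  (forall t q1 q2, inZ (t, q1) -> inZ (t, q2) -> q1 < q2 -> strict Rl (t, q2) (t, q1)) /\
  (forall z, inZ z -> closed_in_Z (fun x => Rl x z) /\ closed_in_Z (fun x => Rl z x)).

Definition single_crossing (R1 R2 : pref) : Prop :=
  forall z1 z2 x y, inZ z1 -> inZ z2 -> inZ x -> inZ y ->
    indiff R1 x z1 -> indiff R1 y z1 -> indiff R2 x z2 -> indiff R2 y z2 -> x = y.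

Definition rich_single_crossing (D : pref -> Prop) : Prop :=
  (forall Rl, D Rl -> classical Rl) /\
  (forall R1 R2, D R1 -> D R2 -> R1 <> R2 -> single_crossing R1 R2) /\
  (forall x1 x2, inZ x1 -> inZ x2 -> lt_pt x1 x2 ->
     exists Rl, D Rl /\ indiff Rl x1 x2).

Definition prec (R1 R2 : pref) : Prop :=
  R1 <> R2 /\
  forall z x, inZ z -> inZ x -> le_pt x z -> R2 x z -> R1 x z.
Definition precsim (R1 R2 : pref) : Prop := R1 = R2 \/ prec R1 R2.

(** Convergence in the order topology of (D, ≺). *)
Definition order_cvg (D : pref -> Prop) (Rs : nat -> pref) (Rl : pref) : Prop :=
  (forall a, D a -> prec a Rl -> exists N, forall n, (N <= n)%nat -> prec a (Rs n)) /\
  (forall b, D b -> prec Rl b -> exists N, forall n, (N <= n)%nat -> prec (Rs n) b).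

Definition monotone_mech (D : pref -> Prop) (F : pref -> pt) : Prop :=
  forall R1 R2, D R1 -> D R2 -> prec R1 R2 -> le_pt (F R1) (F R2).

Definition strategy_proof (D : pref -> Prop) (F : pref -> pt) : Prop :=
  forall R1 R2, D R1 -> D R2 -> R1 (F R1) (F R2).

Definition VF_continuous (D : pref -> Prop) (F : pref -> pt) : Prop :=
  forall (Rl : pref) (Rs : nat -> pref),
    D Rl -> (forall n, D (Rs n)) ->
    ((forall n, precsim (Rs n) (Rs (S n))) \/ (forall n, precsim (Rs (S n)) (Rs n))) ->
    order_cvg D Rs Rl ->
    exists l : pt, filterlim (fun n => F (Rs n)) eventually (locally l) /\
                   indiff Rl l (F Rl).

Definition range_of (D : pref -> Prop) (F : pref -> pt) (x : pt) : Prop :=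
  exists Rl, D Rl /\ F Rl = x.

Definition countable_set (A : pt -> Prop) : Prop :=
  exists g : pt -> nat, forall x y, A x -> A y -> g x = g y -> x = y.

Definition limit_point_Z (A : pt -> Prop) (x : pt) : Prop :=
  inZ x /\ forall eps : posreal, exists y, A y /\ y <> x /\ ball x eps y.

Definition finitely_many_limit_points (A : pt -> Prop) : Prop :=
  exists l : list pt, forall x, limit_point_Z A x -> In x l.

(* Main.v *)
Require Import Defs.
From Stdlib Require Import Reals List Lra Classical ClassicalEpsilon.
From Coquelicot Require Import Coquelicot.

(** A classical preference has a continuous utility normalised to equal the parameter on the
    boundary path of [Z]. By single crossing and richness, [R |-> U_R (1, 1)] is an order
    isomorphism of the domain onto the interval (-1, 1), so a mechanism is a function of a real
    type [x]. Fix a type [a]. Where [F] jumps, the type [x] is indifferent between the two ends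
    of the jump, so by single crossing the utility [U_a (F x)] can only jump down as [x] moves
    away from [a]. If it nevertheless ended up higher somewhere, it would attain a whole
    interval of values, which a countable range forbids. *)

(** * Real analysis *)

(** Cantor's nested intervals: step [n] keeps the closed outer third on the far side of the midpoint
    from [u n], so [u n] is strictly excluded from then on. The supremum [c] of the left ends lies
    in every interval. *)
Lemma interval_not_enumerable (u : nat -> R) (a b : R) :
  a < b -> exists c, a <= c <= b /\ forall n, u n <> c.
Proof.
  intros Hab.
  set (step := fun (r : R) (p : R * R) =>
    if Rlt_dec r ((fst p + snd p) / 2) then ((fst p + 2 * snd p) / 3, snd p)
    else (fst p, (2 * fst p + snd p) / 3)).
  set (I := fix I n := match n with O => (a, b) | S m => step (u m) (I m) end).
  assert (Hlt : forall n, fst (I n) < snd (I n)).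
  { induction n as [|n IH]; simpl; [exact Hab|].
    unfold step; destruct Rlt_dec; simpl; lra. }
  assert (Hstep : forall n, fst (I n) <= fst (I (S n)) /\ snd (I (S n)) <= snd (I n)
            /\ (u n < fst (I (S n)) \/ snd (I (S n)) < u n)).
  { intro n; specialize (Hlt n); simpl; unfold step; destruct Rlt_dec; simpl; lra. }
  assert (Hmon : forall n k, fst (I n) <= fst (I (n + k)%nat) /\ snd (I (n + k)%nat) <= snd (I n)).
  { intros n k; induction k as [|k IH].
    - rewrite Nat.add_0_r; lra.
    - rewrite Nat.add_succ_r; specialize (Hstep (n + k)%nat); lra. }
  assert (Hcross : forall n m, fst (I n) <= snd (I m)).
  { intros n m.
    pose proof (Hmon n m) as H1; pose proof (Hmon m n) as H2; pose proof (Hlt (n + m)%nat).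
    rewrite (Nat.add_comm m n) in H2; lra. }
  destruct (completeness (fun x => exists n, x = fst (I n))) as [c [Hub Hleast]].
  - exists b; intros x [n ->]; exact (Hcross n 0%nat).
  - exists a, 0%nat; reflexivity.
  - assert (Hin : forall n, fst (I n) <= c <= snd (I n)).
    { intro n; split.
      - apply Hub; exists n; reflexivity.
      - apply Hleast; intros x [m ->]; apply Hcross. }
    exists c; split; [exact (Hin 0%nat)|].
    intros n E; specialize (Hstep n); specialize (Hin (S n)); lra.
Qed.

Lemma interval_uncountable (k : R -> nat) (a b : R) :
  a < b -> ~ (forall x y, a < x < b -> a < y < b -> k x = k y -> x = y).
Proof.
  intros Hab Hinj.
  (* The sequence inverts [k] by choice, with arbitrary values off the image of [k]; only its term
     at [k c] matters. The closed middle third keeps [c] strictly inside the open interval. *)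
  destruct (interval_not_enumerable
    (fun n => epsilon (inhabits 0) (fun x => a < x < b /\ k x = n))
    ((2 * a + b) / 3) ((a + 2 * b) / 3)) as [c [Hc Hne]]; [lra|].
  apply (Hne (k c)).
  destruct (epsilon_spec (inhabits 0) (fun x => a < x < b /\ k x = k c)) as [H1 H2].
  - exists c; split; [lra|reflexivity].
  - apply Hinj; [exact H1|lra|exact H2].
Qed.

Lemma lub_increasing_seq (E : R -> Prop) (c : R) :
  is_lub E c -> (exists x, E x) ->
  exists s : nat -> R, (forall n, E (s n)) /\ (forall n, s n <= s (S n)) /\ is_lim_seq s c.
Proof.
  intros [Hub Hleast] [x0 Hx0].
  destruct (classic (E c)) as [Ec|nEc].
  { exists (fun _ => c); repeat split; auto with real. apply is_lim_seq_const. }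
  assert (Hnext : forall y, exists x, y < c -> E x /\ y <= x).
  { intro y; destruct (classic (y < c)) as [Hy|Hy]; [|exists 0; tauto].
    apply NNPP; intro Hn.
    assert (c <= y); [|lra].
    apply Hleast; intros x Ex.
    destruct (Rle_dec x y) as [|Hxy]; [assumption|].
    exfalso; apply Hn; exists x; intros _; split; [exact Ex|lra]. }
  set (next := fun y => epsilon (inhabits 0) (fun x => y < c -> E x /\ y <= x)).
  assert (Hnx : forall y, y < c -> E (next y) /\ y <= next y).
  { intro y; exact (epsilon_spec (inhabits 0) _ (Hnext y)). }
  assert (Elt : forall x, E x -> x < c).
  { intros x Ex; destruct (Rle_lt_or_eq_dec x c (Hub x Ex)) as [| ->]; [assumption|tauto]. }
  (* The first argument of the maximum makes the sequence nondecreasing, the second forces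
     convergence to [c]. Both are below [c], because here [c] is not attained, so [next] always
     applies. *)
  set (s := fix s n := match n with O => x0 | S m => next (Rmax (s m) (c - / (INR m + 1))) end).
  assert (Hpos : forall n, 0 < / (INR n + 1)).
  { intro n; apply Rinv_0_lt_compat; pose proof (pos_INR n); lra. }
  assert (HE : forall n, E (s n)).
  { induction n as [|n IH]; simpl; [exact Hx0|].
    apply Hnx, Rmax_lub_lt; [apply Elt, IH|specialize (Hpos n); lra]. }
  assert (Hs : forall n, Rmax (s n) (c - / (INR n + 1)) <= s (S n)).
  { intro n; simpl; apply Hnx, Rmax_lub_lt; [apply Elt, HE|specialize (Hpos n); lra]. }
  exists s; split; [exact HE|split].
  - intro n; eapply Rle_trans; [apply Rmax_l|apply Hs].
  - apply is_lim_seq_incr_1.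
    apply is_lim_seq_le_le with (u := fun n => c - / (INR n + 1)) (w := fun _ => c).
    + intro n; split; [eapply Rle_trans; [apply Rmax_r|apply Hs]|apply Hub, HE].
    + replace (Finite c) with (Finite (c - 0)) by (f_equal; ring).
      apply is_lim_seq_minus'; [apply is_lim_seq_const|].
      apply (is_lim_seq_inv _ p_infty); [|discriminate].
      apply (is_lim_seq_ext (fun n => INR (S n))); [intro; apply S_INR|].
      apply (is_lim_seq_incr_1 INR), is_lim_seq_INR.
    + apply is_lim_seq_const.
Qed.

(* At the last point where [g <= v], the left hypothesis gives [g <= v] and the right one
   gives [g >= v]: a function whose jumps all go down attains every intermediate value on
   the way up. *)
Lemma intermediate_value_down_jumps (g : R -> R) (a b : R) :
  a < b ->
  (forall v s c, (forall n, a <= s n <= b) -> (forall n, s n <= s (S n)) ->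
     a <= c <= b -> is_lim_seq s c -> (forall n, g (s n) <= v) -> g c <= v) ->
  (forall v s c, (forall n, a <= s n <= b) -> (forall n, s (S n) <= s n) ->
     a <= c <= b -> is_lim_seq s c -> (forall n, v <= g (s n)) -> v <= g c) ->
  forall v, g a < v < g b -> exists c, a <= c <= b /\ g c = v.
Proof.
  intros Hab HL HR v Hv.
  set (E := fun x => a <= x <= b /\ g x <= v).
  assert (Ea : E a) by (unfold E; lra).
  destruct (completeness E) as [c Hc].
  - exists b; intros x [Hx _]; lra.
  - exists a; exact Ea.
  - assert (Hcab : a <= c <= b).
    { split; [apply Hc, Ea|apply Hc; intros x [Hx _]; lra]. }
    assert (Hgc : g c <= v).
    { destruct (lub_increasing_seq E c Hc) as [s [Hs [Hinc Hlim]]]; [exists a; exact Ea|].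
      apply (HL v s c); try assumption; intro n; apply (Hs n). }
    assert (Hcb : c < b).
    { destruct (Rle_lt_or_eq_dec c b) as [| ->]; [lra|assumption|lra]. }
    exists c; split; [exact Hcab|].
    apply Rle_antisym; [exact Hgc|].
    assert (Hpos : forall n, 0 < / (INR n + 1) <= 1).
    { intro n; pose proof (pos_INR n); split; [apply Rinv_0_lt_compat; lra|].
      rewrite <- Rinv_1; apply Rinv_le_contravar; lra. }
    (* These points decrease to [c] from the right and stay in the segment. As [c] bounds [E] from
       above, [g] exceeds [v] at each of them. *)
    assert (Hin : forall n, c < c + (b - c) * / (INR n + 1) <= b).
    { intro n; specialize (Hpos n); nra. }
    apply (HR v (fun n => c + (b - c) * / (INR n + 1)) c); try assumption.
    + intro n; specialize (Hin n); lra.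
    + intro n; rewrite S_INR; pose proof (pos_INR n).
      assert (/ (INR n + 1 + 1) <= / (INR n + 1)) by (apply Rinv_le_contravar; lra).
      nra.
    + replace (Finite c) with (Finite (c + (b - c) * 0)) by (f_equal; ring).
      apply is_lim_seq_plus'; [apply is_lim_seq_const|].
      apply (is_lim_seq_scal_l _ (b - c) 0).
      apply (is_lim_seq_inv _ p_infty); [|discriminate].
      apply (is_lim_seq_ext (fun n => INR (S n))); [intro; apply S_INR|].
      apply (is_lim_seq_incr_1 INR), is_lim_seq_INR.
    + intro n; specialize (Hin n).
      destruct (Rle_dec (g (c + (b - c) * / (INR n + 1))) v) as [Hle|]; [|lra].
      assert (c + (b - c) * / (INR n + 1) <= c); [|lra].
      apply Hc; split; [lra|exact Hle].
Qed.

Lemma Lipschitz1_continuous (f : R -> R) :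
  (forall x y, Rabs (f y - f x) <= Rabs (y - x)) -> forall x, continuous f x.
Proof.
  intros Hf x; apply filterlim_locally; intro eps; exists eps; intros y Hy.
  eapply Rle_lt_trans; [apply Hf|exact Hy].
Qed.

Lemma continuous_Rmax_l (c x : R) : continuous (Rmax c) x.
Proof.
  apply Lipschitz1_continuous; intros y z.
  unfold Rmax, Rabs; repeat destruct Rle_dec; repeat destruct Rcase_abs; lra.
Qed.

Lemma continuous_Rmin_l (c x : R) : continuous (Rmin c) x.
Proof.
  apply Lipschitz1_continuous; intros y z.
  unfold Rmin, Rabs; repeat destruct Rle_dec; repeat destruct Rcase_abs; lra.
Qed.

Lemma continuous_pair {T U V : UniformSpace} (f : T -> U) (g : T -> V) (x : T) :
  continuous f x -> continuous g x -> continuous (fun y => (f y, g y)) x.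
Proof.
  intros Hf Hg; apply (continuous_comp_2 f g pair x Hf Hg).
  apply (continuous_ext (fun p => p)); [intros [? ?]; reflexivity|apply continuous_id].
Qed.

(** Connectedness of a segment. The supremum [c] of [B] on the segment lies in [B] by closedness. If
    [c] were outside the closed set [A], points just above it would have to be in [B], or [c] would
    be [b], which is in [A]. *)
Lemma closed_cover_meet (A B : R -> Prop) (a b : R) :
  a <= b -> closed A -> closed B -> (forall s, a <= s <= b -> A s \/ B s) ->
  B a -> A b -> exists s, a <= s <= b /\ A s /\ B s.
Proof.
  intros Hab HA HB Hcov Ba Ab.
  set (E := fun s => a <= s <= b /\ B s).
  assert (Ea : E a) by (split; [lra|exact Ba]).
  destruct (completeness E) as [c Hc].
  - exists b; intros x [Hx _]; lra.
  - exists a; exact Ea.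
  - assert (Hcab : a <= c <= b).
    { split; [apply Hc, Ea|apply Hc; intros x [Hx _]; lra]. }
    assert (Bc : B c).
    { destruct (lub_increasing_seq E c Hc) as [s [Hs [_ Hlim]]]; [exists a; exact Ea|].
      apply (closed_filterlim (F := eventually) s B c Hlim); [|exact HB].
      intro n; apply (Hs n). }
    exists c; split; [exact Hcab|split; [|exact Bc]].
    apply HA; intro Hno.
    destruct Hno as [eps Heps].
    destruct (Rle_lt_or_eq_dec c b) as [Hcb|E1]; [lra| |].
    + set (y := Rmin b (c + eps / 2)).
      assert (Hy : c < y <= b /\ y <= c + eps / 2).
      { pose proof (cond_pos eps); unfold y, Rmin; destruct Rle_dec; lra. }
      apply (Heps y).
      * change (Rabs (y - c) < eps); pose proof (cond_pos eps); rewrite Rabs_pos_eq; lra.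
      * destruct (Hcov y) as [|By]; [lra|assumption|].
        assert (y <= c); [|lra]. apply Hc; split; [lra|exact By].
    + apply (Heps c); [apply ball_center|rewrite E1; exact Ab].
Qed.

Lemma IVT_segment (f : R -> R) (a b v : R) :
  (forall x, continuous f x) -> a <= b -> f a <= v <= f b ->
  exists x, a <= x <= b /\ f x = v.
Proof.
  intros Hf Hab Hv.
  destruct (IVT_gen_consistent f a b v Hf) as [x Hx].
  - rewrite Rmin_left, Rmax_right; lra.
  - rewrite Rmin_left, Rmax_right in Hx by lra; exists x; exact Hx.
Qed.

(** * Canonical utilities *)

(* The boundary path of [Z] that comes in from [t = +oo] along [q = 0] and then climbs
   [t = 0]; every classical preference strictly increases along it. *)
Definition boundary_path (s : R) : pt := (Rmax 0 (- s), Rmax 0 s).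

(** Nearest-point retraction of the plane onto [Z]. Composing with it states continuity on [Z] in
    the topology of the whole plane, with no subspace topology. *)
Definition retract_Z (p : pt) : pt := (Rmax 0 (fst p), Rmax 0 (Rmin 1 (snd p))).

Definition canonical_utility (u : pt -> R) : Prop :=
  (forall t1 t2 q, 0 <= t1 < t2 -> 0 <= q <= 1 -> u (t2, q) < u (t1, q)) /\
  (forall t q1 q2, 0 <= t -> 0 <= q1 -> q1 < q2 <= 1 -> u (t, q1) < u (t, q2)) /\
  (forall s, s <= 1 -> u (boundary_path s) = s) /\
  (forall p : pt, continuous (fun p' => u (retract_Z p')) p).

Definition represents (Rl : pref) (u : pt -> R) : Prop :=
  forall x y, inZ x -> inZ y -> (Rl x y <-> u y <= u x).

Lemma retract_Z_id (p : pt) : inZ p -> retract_Z p = p.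
Proof.
  destruct p as [t q]; intros [Ht Hq]; simpl in *; unfold retract_Z; simpl.
  rewrite Rmin_right, !Rmax_right by (try rewrite Rmin_right; lra); reflexivity.
Qed.

Lemma retract_Z_inZ (p : pt) : inZ (retract_Z p).
Proof.
  unfold inZ, retract_Z; simpl; unfold Rmax, Rmin; repeat destruct Rle_dec; lra.
Qed.

Lemma continuous_retract_Z (p : pt) : continuous retract_Z p.
Proof.
  destruct p as [t q]; apply continuous_pair.
  - apply continuous_comp; [apply continuous_fst|apply continuous_Rmax_l].
  - apply (continuous_comp (fun p : pt => Rmin 1 (snd p))); [|apply continuous_Rmax_l].
    apply continuous_comp; [apply continuous_snd|apply continuous_Rmin_l].
Qed.

Lemma boundary_path_nonneg (s : R) : 0 <= s -> boundary_path s = (0, s).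
Proof. intro H; unfold boundary_path; rewrite Rmax_left, Rmax_right by lra; reflexivity. Qed.

Lemma boundary_path_nonpos (s : R) : s <= 0 -> boundary_path s = (- s, 0).
Proof. intro H; unfold boundary_path; rewrite Rmax_right, Rmax_left by lra; reflexivity. Qed.

Lemma boundary_path_inZ (s : R) : s <= 1 -> inZ (boundary_path s).
Proof.
  intro; unfold inZ, boundary_path; simpl; unfold Rmax; repeat destruct Rle_dec; lra.
Qed.

Lemma continuous_boundary_path (s : R) : continuous boundary_path s.
Proof.
  apply continuous_pair.
  - apply (continuous_comp Ropp (Rmax 0)); [|apply continuous_Rmax_l].
    apply (continuous_opp (fun x : R => x)), continuous_id.
  - apply continuous_Rmax_l.
Qed.

Lemma closed_in_Z_retract (A : pt -> Prop) :
  closed_in_Z A -> closed (fun p => A (retract_Z p)).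
Proof.
  intros [C [HC HA]].
  apply (closed_ext (fun p => C (retract_Z p))).
  - intro p; symmetry; apply HA, retract_Z_inZ.
  - exact (closed_comp (retract_Z : prod_UniformSpace R_UniformSpace R_UniformSpace -> _) C
      continuous_retract_Z HC).
Qed.

Lemma strict_boundary_path (Rl : pref) (s1 s2 : R) :
  classical Rl -> s1 < s2 <= 1 -> strict Rl (boundary_path s2) (boundary_path s1).
Proof.
  intros (Hc & Htr & Ht & Hq & _) Hs.
  assert (Hneg : forall a b, a < b <= 0 -> strict Rl (boundary_path b) (boundary_path a)).
  { intros a b Hab; rewrite !boundary_path_nonpos by lra.
    apply Ht; unfold inZ; simpl; lra. }
  assert (Hpos : forall a b, 0 <= a -> a < b <= 1 -> strict Rl (boundary_path b) (boundary_path a)).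
  { intros a b Ha Hab; rewrite !boundary_path_nonneg by lra.
    apply Hq; unfold inZ; simpl; lra. }
  destruct (Rle_dec s2 0); [apply Hneg; lra|].
  destruct (Rle_dec 0 s1); [apply Hpos; lra|].
  (* What remains is [s1 < 0 < s2]: the two strict comparisons are chained through the corner of the
     path, at parameter 0. *)
  destruct (Hneg s1 0) as [A1 A2]; [lra|]. destruct (Hpos 0 s2) as [B1 B2]; [lra|lra|].
  pose proof (boundary_path_inZ s1) as Z1. pose proof (boundary_path_inZ s2) as Z2.
  pose proof (boundary_path_inZ 0) as Z0.
  split.
  - apply (Htr _ (boundary_path 0)); auto; [apply Z2|apply Z0|apply Z1]; lra.
  - intro H; apply B2, (Htr _ (boundary_path s1)); auto; [apply Z0|apply Z1|apply Z2]; lra.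
Qed.

(** Along the path from [(t, 0)], weakly worse than [z], to [(0, 1)], weakly better, the upper and
    lower contour sets of [z] are closed and cover by completeness of the preference, so by
    connectedness they meet. *)
Lemma indiff_boundary_path (Rl : pref) (z : pt) :
  classical Rl -> inZ z -> exists s, s <= 1 /\ indiff Rl (boundary_path s) z.
Proof.
  intros HR Hz; pose proof HR as (Hc & Htr & Ht & Hq & Hcl).
  destruct z as [t q]; pose proof Hz as [Hz1 Hz2]; simpl in Hz1, Hz2.
  assert (Hrefl : forall x, inZ x -> Rl x x) by (intros x Hx; destruct (Hc x x Hx Hx); assumption).
  assert (Htw : forall t1 t2 q', 0 <= t1 <= t2 -> 0 <= q' <= 1 -> Rl (t1, q') (t2, q')).
  { intros t1 t2 q' H1 H2; destruct (Req_dec t1 t2) as [->|];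
      [apply Hrefl|apply Ht]; unfold inZ; simpl; lra. }
  assert (Hqw : forall t' q1 q2, 0 <= t' -> 0 <= q1 <= q2 -> q2 <= 1 -> Rl (t', q2) (t', q1)).
  { intros t' q1 q2 H1 H2 H3; destruct (Req_dec q1 q2) as [->|];
      [apply Hrefl|apply Hq]; unfold inZ; simpl; lra. }
  destruct (Hcl _ Hz) as [Cup Clow].
  assert (Hclosed : forall A, closed_in_Z A ->
            closed (fun s => A (retract_Z (boundary_path s)))).
  { intros A HA.
    exact (closed_comp boundary_path (fun p => A (retract_Z p)) continuous_boundary_path
             (closed_in_Z_retract A HA)). }
  destruct (closed_cover_meet _ _ (- t) 1 ltac:(lra) (Hclosed _ Cup) (Hclosed _ Clow))
    as [s [Hs [H1 H2]]].
  - intros s Hs; apply Hc; [apply retract_Z_inZ|exact Hz].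
  - rewrite retract_Z_id by (apply boundary_path_inZ; lra).
    rewrite boundary_path_nonpos, Ropp_involutive by lra; apply Hqw; lra.
  - rewrite retract_Z_id by (apply boundary_path_inZ; lra).
    rewrite boundary_path_nonneg by lra.
    apply (Htr _ (0, q)); try (unfold inZ; simpl; lra); [apply Hqw|apply Htw]; lra.
  - rewrite retract_Z_id in H1, H2 by (apply boundary_path_inZ; lra).
    exists s; split; [lra|split; assumption].
Qed.

(** The utility of [z] is the parameter of the path point indifferent to it. Continuity holds
    because strict sublevel and superlevel sets are complements of contour sets of path points,
    which are closed. *)
Lemma classical_canonical_utility (Rl : pref) :
  classical Rl -> exists u, canonical_utility u /\ represents Rl u.
Proof.
  intros HR; pose proof HR as (Hc & Htr & Ht & Hq & Hcl).
  set (u := fun z => epsilon (inhabits 0) (fun s => s <= 1 /\ indiff Rl (boundary_path s) z)).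
  assert (Hu : forall z, inZ z -> u z <= 1 /\ indiff Rl (boundary_path (u z)) z).
  { intros z Hz; exact (epsilon_spec (inhabits 0) _ (indiff_boundary_path Rl z HR Hz)). }
  assert (Hbp : forall s1 s2, s1 <= 1 -> s2 <= 1 ->
            (Rl (boundary_path s1) (boundary_path s2) <-> s2 <= s1)).
  { intros s1 s2 H1 H2; split; intro H.
    - destruct (Rle_dec s2 s1); [assumption|].
      destruct (strict_boundary_path Rl s1 s2 HR); [lra|contradiction].
    - destruct (Req_dec s1 s2) as [->|].
      + pose proof (boundary_path_inZ s2 H2) as Z; destruct (Hc _ _ Z Z); assumption.
      + apply (strict_boundary_path Rl s2 s1 HR); lra. }
  assert (Hrep : represents Rl u).
  { intros x y Hx Hy.
    destruct (Hu x Hx) as [Ux [X1 X2]]; destruct (Hu y Hy) as [Uy [Y1 Y2]].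
    pose proof (boundary_path_inZ _ Ux) as Zx; pose proof (boundary_path_inZ _ Uy) as Zy.
    rewrite <- (Hbp (u x) (u y) Ux Uy); split; intro H.
    - apply (Htr _ x); auto; apply (Htr _ y); auto.
    - apply (Htr _ (boundary_path (u x))); auto; apply (Htr _ (boundary_path (u y))); auto. }
  assert (Hstrict : forall x y, inZ x -> inZ y -> strict Rl x y -> u y < u x).
  { intros x y Hx Hy [H1 H2]; destruct (Rlt_dec (u y) (u x)); [assumption|].
    exfalso; apply H2, Hrep; auto; lra. }
  assert (Hpath : forall s, s <= 1 -> u (boundary_path s) = s).
  { intros s Hs; destruct (Hu _ (boundary_path_inZ s Hs)) as [H1 [H2 H3]].
    apply Hbp in H2, H3; auto; lra. }
  exists u; split; [|exact Hrep].
  repeat split.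
  - intros t1 t2 q H1 H2; apply Hstrict; [| |apply Ht]; try (unfold inZ; simpl; lra); lra.
  - intros t q1 q2 H1 H2 H3; apply Hstrict; [| |apply Hq]; try (unfold inZ; simpl; lra); lra.
  - exact Hpath.
  - intro p; apply filterlim_locally; intro eps.
    set (a := u (retract_Z p)).
    assert (Ha : a <= 1) by apply (Hu _ (retract_Z_inZ p)).
    pose proof (cond_pos eps) as He.
    assert (Hup : locally p (fun p' => u (retract_Z p') < a + eps)).
    (* The path stops at parameter 1. Above that level there is no path point to compare with, but
       the bound is then automatic since [u] is at most 1 on [Z]. *)
    { destruct (Rle_dec (a + eps) 1) as [H1|H1].
      - destruct (Hcl _ (boundary_path_inZ _ H1)) as [C _].
        apply closed_in_Z_retract, open_not in C.
        apply (locally_open _ _ C).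
        + intros p' Hp'.
          destruct (Rlt_dec (u (retract_Z p')) (a + eps)); [assumption|].
          exfalso; apply Hp', Hrep; [apply retract_Z_inZ|apply boundary_path_inZ; lra|].
          rewrite Hpath; lra.
        + intro H; apply Hrep in H; [|apply retract_Z_inZ|apply boundary_path_inZ; lra].
          rewrite Hpath in H by lra; fold a in H; lra.
      - apply filter_forall; intro p'.
        destruct (Hu _ (retract_Z_inZ p')); lra. }
    assert (Hlow : locally p (fun p' => a - eps < u (retract_Z p'))).
    { assert (H1 : a - eps <= 1) by lra.
      destruct (Hcl _ (boundary_path_inZ _ H1)) as [_ C].
      apply closed_in_Z_retract, open_not in C.
      apply (locally_open _ _ C).
      + intros p' Hp'.
        destruct (Rlt_dec (a - eps) (u (retract_Z p'))); [assumption|].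
        exfalso; apply Hp', Hrep; [apply boundary_path_inZ; lra|apply retract_Z_inZ|].
        rewrite Hpath; lra.
      + intro H; apply Hrep in H; [|apply boundary_path_inZ; lra|apply retract_Z_inZ].
        rewrite Hpath in H by lra; fold a in H; lra. }
    generalize (filter_and _ _ Hup Hlow); apply filter_imp; intros p' [H1 H2].
    change (Rabs (u (retract_Z p') - a) < eps); apply Rabs_def1; lra.
Qed.

(** * Single crossing *)

(** This is single crossing for utilities: a level curve of [u1] and one of [u2] share at most one
    point. *)
Definition jointly_injective (u1 u2 : pt -> R) : Prop :=
  forall x y, inZ x -> inZ y -> u1 x = u1 y -> u2 x = u2 y -> x = y.

(** The bounds are the utilities of [(t, 0)] and [(0, q)], which lie on the boundary path;
    monotonicity in each coordinate does the rest. *)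
Lemma canonical_utility_bounds (u : pt -> R) (t q : R) :
  canonical_utility u -> inZ (t, q) -> - t <= u (t, q) <= q.
Proof.
  intros (Ht & Hq & Hp & _) [H1 H2]; simpl in H1, H2.
  assert (E1 : u (t, 0) = - t).
  { rewrite <- (Ropp_involutive t) at 1; rewrite <- boundary_path_nonpos by lra; apply Hp; lra. }
  assert (E2 : u (0, q) = q) by (rewrite <- boundary_path_nonneg by lra; apply Hp; lra).
  split.
  - destruct (Req_dec q 0) as [->|]; [lra|]. specialize (Hq t 0 q); lra.
  - destruct (Req_dec t 0) as [->|]; [lra|]. specialize (Ht 0 t q); lra.
Qed.

Lemma canonical_utility_bounds_strict (u : pt -> R) (t q : R) :
  canonical_utility u -> inZ (t, q) -> 0 < t -> 0 < q -> - t < u (t, q) < q.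
Proof.
  intros Hu [H1 H2] Htp Hqp; simpl in H1, H2.
  pose proof (canonical_utility_bounds u t 0 Hu ltac:(unfold inZ; simpl; lra)).
  pose proof (canonical_utility_bounds u 0 q Hu ltac:(unfold inZ; simpl; lra)).
  destruct Hu as (Ht & Hq & _).
  specialize (Hq t 0 q); specialize (Ht 0 t q); lra.
Qed.

Lemma canonical_utility_le1 (u : pt -> R) (z : pt) : canonical_utility u -> inZ z -> u z <= 1.
Proof.
  intros Hu Hz; destruct z as [t q].
  pose proof (canonical_utility_bounds u t q Hu Hz); destruct Hz as [_ Hz]; simpl in Hz; lra.
Qed.

Lemma continuous_canonical_utility_comp (u : pt -> R) (f g : R -> R) (x : R) :
  canonical_utility u -> continuous f x -> continuous g x ->
  continuous (fun s => u (retract_Z (f s, g s))) x.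
Proof.
  intros (_ & _ & _ & Hc) Hf Hg.
  apply (continuous_comp (fun s => (f s, g s) : pt) (fun p => u (retract_Z p)));
    [apply continuous_pair; assumption|apply Hc].
Qed.

(* Both utilities agree with the parameter on the boundary path, so equality at [z] would make
   [z] and the point of level [u1 z] on the path a double crossing. *)
Lemma interior_utility_neq (u1 u2 : pt -> R) (t q : R) :
  canonical_utility u1 -> canonical_utility u2 -> jointly_injective u1 u2 ->
  inZ (t, q) -> 0 < t -> 0 < q -> u1 (t, q) <> u2 (t, q).
Proof.
  intros H1 H2 Hinj Hz Ht Hq E.
  pose proof (canonical_utility_le1 _ _ H1 Hz) as Hle.
  assert (E' : boundary_path (u1 (t, q)) = (t, q)).
  { apply Hinj; [apply boundary_path_inZ, Hle|exact Hz| |].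
    - apply H1, Hle.
    - rewrite <- E; apply H2, Hle. }
  unfold boundary_path in E'; injection E' as E1 E2.
  unfold Rmax in E1, E2; repeat destruct Rle_dec in E1; repeat destruct Rle_dec in E2; lra.
Qed.

(** The points with positive coordinates form a convex part of [Z] on which the continuous
    difference [u1 - u2] never vanishes. Its sign is therefore the one at [(1, 1)]; a sign change
    would give a zero on the segment from [(1, 1)] to [(t, q)]. *)
Lemma interior_utility_lt (u1 u2 : pt -> R) (t q : R) :
  canonical_utility u1 -> canonical_utility u2 -> jointly_injective u1 u2 ->
  u1 (1, 1) < u2 (1, 1) ->
  inZ (t, q) -> 0 < t -> 0 < q -> u1 (t, q) < u2 (t, q).
Proof.
  intros H1 H2 Hinj Hlt Hz Ht Hq.
  destruct (Rlt_dec (u1 (t, q)) (u2 (t, q))) as [|Hn]; [assumption|exfalso].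
  set (f := fun s : R => 1 + s * (t - 1)); set (g := fun s : R => 1 + s * (q - 1)).
  assert (Haff : forall c s : R, continuous (fun s => 1 + s * c) s).
  { intros c s; apply (continuous_plus (V := R_NormedModule)); [apply continuous_const|].
    apply (continuous_mult (fun s : R => s) (fun _ => c)); [apply continuous_id|apply continuous_const]. }
  assert (Hz1 : inZ (1, 1)) by (unfold inZ; simpl; lra).
  destruct (IVT_segment
    (fun s => u1 (retract_Z (f s, g s)) - u2 (retract_Z (f s, g s))) 0 1 0)
    as [s [Hs Es]].
  - intro s; apply (continuous_minus (V := R_NormedModule));
      apply continuous_canonical_utility_comp; try assumption; apply Haff.
  - lra.
  - unfold f, g; rewrite !Rmult_0_l, !Rmult_1_l, Rplus_0_r.
    replace (1 + (t - 1)) with t by ring; replace (1 + (q - 1)) with q by ring.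
    rewrite !retract_Z_id by assumption; lra.
  - assert (Hpos : 0 < f s /\ 0 < g s <= 1).
    { destruct Hz as [_ [_ Hq1]]; simpl in Hq1; unfold f, g; nra. }
    assert (Hz' : inZ (f s, g s)) by (unfold inZ; simpl; lra).
    rewrite retract_Z_id in Es by exact Hz'.
    apply (interior_utility_neq u1 u2 (f s) (g s)); try assumption; lra.
Qed.

(* The utility is extended past [q = 0] and [q = 1] with slope one, so that its level curves
   are graphs over the whole line. *)
Lemma indifference_curve (u : pt -> R) (s t0 t1 : R) :
  canonical_utility u -> 0 <= t0 <= t1 ->
  u (t0, 0) <= s -> s <= u (t1, 1) ->
  exists h : R -> R, (forall t, continuous h t) /\
    forall t, t0 <= t <= t1 -> 0 <= h t <= 1 /\ u (t, h t) = s.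
Proof.
  intros Hu Ht01 Hs0 Hs1; pose proof Hu as (Hmt & Hmq & _ & Hcont).
  set (clip := fun q => Rmax 0 (Rmin 1 q)).
  set (w := fun t q => u (retract_Z (t, q)) + (q - clip q)).
  assert (Hw : forall t q, w t q = u (Rmax 0 t, clip q) + (q - clip q)) by reflexivity.
  assert (Hcc : forall q, continuous clip q).
  { intro q; apply (continuous_comp (Rmin 1) (Rmax 0));
      [apply continuous_Rmin_l|apply continuous_Rmax_l]. }
  assert (Hwc : forall (f g : R -> R) x, continuous f x -> continuous g x ->
            continuous (fun y => w (f y) (g y)) x).
  { intros f g x Hf Hg; apply (continuous_plus (V := R_NormedModule)).
    - apply continuous_canonical_utility_comp; assumption.
    - apply (continuous_minus (V := R_NormedModule)); [exact Hg|].
      apply (continuous_comp g clip); [exact Hg|apply Hcc]. }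
  assert (Hwm : forall t q1 q2, q1 < q2 -> w t q1 < w t q2).
  { intros t q1 q2 Hq; rewrite !Hw.
    assert (Hcl : clip q1 <= clip q2 /\ 0 <= clip q1 /\ clip q2 <= 1 /\
      (clip q1 < clip q2 \/ clip q1 = clip q2) /\ q1 - clip q1 <= q2 - clip q2).
    { unfold clip, Rmax, Rmin; repeat destruct Rle_dec; lra. }
    destruct Hcl as (_ & B0 & B1 & [Hlt|Heq] & Hd).
    - specialize (Hmq (Rmax 0 t) (clip q1) (clip q2) (Rmax_l _ _)); lra.
    - rewrite Heq; lra. }
  assert (Hex : forall t, exists q, w t q = s).
  { intro t.
    set (A := u (Rmax 0 t, 0)); set (B := u (Rmax 0 t, 1)).
    (* Far enough out on the slope-one extensions to lie below and above the level [s]. *)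
    set (q0 := - Rabs (s - A) - 1); set (q1 := 2 + Rabs (s - B)).
    pose proof (Rle_abs (s - B)); pose proof (Rle_abs (- (s - A))) as HA; rewrite Rabs_Ropp in HA.
    pose proof (Rabs_pos (s - A)); pose proof (Rabs_pos (s - B)).
    assert (C0 : clip q0 = 0) by (unfold clip, q0, Rmax, Rmin; repeat destruct Rle_dec; lra).
    assert (C1 : clip q1 = 1) by (unfold clip, q1, Rmax, Rmin; repeat destruct Rle_dec; lra).
    destruct (IVT_segment (w t) q0 q1 s) as [q [_ Hq]].
    - intro q; apply (Hwc (fun _ => t) (fun y => y)); [apply continuous_const|apply continuous_id].
    - unfold q0, q1; lra.
    - rewrite !Hw, C0, C1; fold A B; unfold q0, q1; lra.
    - exists q; exact Hq. }
  set (h := fun t => epsilon (inhabits 0) (fun q => w t q = s)).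
  assert (Hh : forall t, w t (h t) = s).
  { intro t; exact (epsilon_spec (inhabits 0) _ (Hex t)). }
  assert (Hlt : forall t q, w t q < s -> q < h t).
  { intros t q H; destruct (Rlt_dec q (h t)) as [|Hn]; [assumption|].
    specialize (Hh t); destruct (Req_dec q (h t)) as [->|]; [lra|].
    specialize (Hwm t (h t) q); lra. }
  assert (Hgt : forall t q, s < w t q -> h t < q).
  { intros t q H; destruct (Rlt_dec (h t) q) as [|Hn]; [assumption|].
    specialize (Hh t); destruct (Req_dec q (h t)) as [->|]; [lra|].
    specialize (Hwm t q (h t)); lra. }
  exists h; split.
  (* For [t'] near [t], continuity in the first argument keeps the heights [h t - eps] and
     [h t + eps] strictly on either side of the level [s]; strict monotonicity in the second traps
     [h t'] between them. *)
  - intro t; apply filterlim_locally; intro eps; pose proof (cond_pos eps) as He.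
    assert (L : locally t (fun t' => w t' (h t - eps) < s)).
    { apply (locally_open (fun t' => w t' (h t - eps) < s) _); [|auto|].
      - apply (open_comp (fun t' => w t' (h t - eps)) (fun y => y < s)); [|apply open_lt].
        intros x _; apply (Hwc (fun y => y) (fun _ => h t - eps));
          [apply continuous_id|apply continuous_const].
      - rewrite <- (Hh t); apply Hwm; lra. }
    assert (U : locally t (fun t' => s < w t' (h t + eps))).
    { apply (locally_open (fun t' => s < w t' (h t + eps)) _); [|auto|].
      - apply (open_comp (fun t' => w t' (h t + eps)) (fun y => s < y)); [|apply open_gt].
        intros x _; apply (Hwc (fun y => y) (fun _ => h t + eps));
          [apply continuous_id|apply continuous_const].
      - rewrite <- (Hh t) at 1; apply Hwm; lra. }
    generalize (filter_and _ _ L U); apply filter_imp; intros t' [A B].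
    apply Hlt in A; apply Hgt in B.
    change (Rabs (h t' - h t) < eps); apply Rabs_def1; lra.
  - intros t Ht.
    assert (Hwin : forall q, 0 <= q <= 1 -> w t q = u (t, q)).
    { intros q Hq; rewrite Hw; unfold clip.
      rewrite Rmin_right, !Rmax_right by (try rewrite Rmin_right; lra); ring. }
    assert (H0 : u (t, 0) <= s).
    { destruct (Req_dec t0 t) as [->|]; [assumption|]. specialize (Hmt t0 t 0); lra. }
    assert (H1 : s <= u (t, 1)).
    { destruct (Req_dec t t1) as [->|]; [assumption|]. specialize (Hmt t t1 1); lra. }
    assert (Hin : 0 <= h t <= 1).
    { rewrite <- Hwin in H0, H1 by lra; rewrite <- (Hh t) in H0, H1; split.
      - destruct (Rle_dec 0 (h t)); [assumption|]. specialize (Hwm t (h t) 0); lra.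
      - destruct (Rle_dec (h t) 1); [assumption|]. specialize (Hwm t 1 (h t)); lra. }
    split; [exact Hin|]. rewrite <- Hwin by exact Hin; apply Hh.
Qed.

Lemma canonical_utility_level_inj (u : pt -> R) (t q1 q2 : R) :
  canonical_utility u -> inZ (t, q1) -> inZ (t, q2) -> u (t, q1) = u (t, q2) -> q1 = q2.
Proof.
  intros (_ & Hq & _) [A1 A2] [_ B2] E; simpl in *.
  destruct (Rtotal_order q1 q2) as [H|[H|H]]; [|assumption|].
  - specialize (Hq t q1 q2); lra.
  - specialize (Hq t q2 q1); lra.
Qed.

(* Along an indifference curve of [u1], starting on the boundary path, [u2] is injective and
   starts at its minimum, so it increases. *)
Lemma utility_lt_along_indifference (u1 u2 : pt -> R) (x z : pt) :
  canonical_utility u1 -> canonical_utility u2 -> jointly_injective u1 u2 ->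
  u1 (1, 1) < u2 (1, 1) ->
  inZ x -> inZ z -> lt_pt x z -> u1 x = u1 z -> u2 x < u2 z.
Proof.
  intros H1 H2 Hinj Hlt Hx Hz Hxz E.
  destruct x as [tx qx], z as [tz qz]; destruct Hxz as [Htlt Hqlt]; simpl in Htlt, Hqlt.
  pose proof Hx as [Hx1 Hx2]; pose proof Hz as [Hz1 Hz2]; simpl in Hx1, Hx2, Hz1, Hz2.
  pose proof (canonical_utility_le1 _ _ H1 Hx) as Hs.
  pose proof (canonical_utility_bounds _ _ _ H1 Hx) as Hb.
  assert (Hz' : u1 (tz, qz) < u2 (tz, qz)) by (apply interior_utility_lt; auto; lra).
  assert (Hp1 : forall s, s <= 1 -> u1 (boundary_path s) = s) by apply H1.
  assert (Hp2 : forall s, s <= 1 -> u2 (boundary_path s) = s) by apply H2.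
  set (s := u1 (tx, qx)) in *.
  destruct (classic (0 < tx /\ 0 < qx)) as [[Htx Hqx]|Hbd].
  - assert (Hx' : s < u2 (tx, qx)) by (apply interior_utility_lt; auto; lra).
    destruct (Rlt_dec (u2 (tx, qx)) (u2 (tz, qz))) as [|Hn]; [assumption|exfalso].
    (* The point [(tg, qg)] is where the indifference curve of [u1] at level [s] meets the boundary
       path, so both utilities equal [s] there. *)
    destruct (boundary_path s) as [tg qg] eqn:Eg.
    pose proof (boundary_path_inZ s Hs) as Hg; rewrite Eg in Hg; pose proof Hg as [Hg1 Hg2];
      simpl in Hg1, Hg2.
    assert (Hug : u1 (tg, qg) = s /\ u2 (tg, qg) = s) by (rewrite <- Eg; auto).
    assert (Htg : tg <= tx).
    { unfold boundary_path in Eg; injection Eg as Eg _; rewrite <- Eg.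
      apply Rmax_lub; lra. }
    pose proof H1 as (Hmt & Hmq & _).
    destruct (indifference_curve u1 s tg tx H1) as [h [Hc Hh]]; [lra| | |].
    + destruct (Req_dec qg 0) as [->|]; [lra|]. specialize (Hmq tg 0 qg); lra.
    + unfold s; destruct (Req_dec qx 1) as [->|]; [lra|]. specialize (Hmq tx qx 1); lra.
    + assert (Hhg : h tg = qg).
      { destruct (Hh tg) as [A B]; [lra|].
        apply (canonical_utility_level_inj u1 tg); auto; [unfold inZ; simpl; lra|lra]. }
      assert (Hhx : h tx = qx).
      { destruct (Hh tx) as [A B]; [lra|].
        apply (canonical_utility_level_inj u1 tx); auto; unfold inZ; simpl; lra. }
      (* On the curve [u2] starts at [s], below its value at [z], and is assumed to be at least that
         value at [x]. It thus takes the value already at some [t <= tx < tz], a second common point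
         of the two level curves through [z]. *)
      destruct (IVT_segment (fun t => u2 (retract_Z (t, h t))) tg tx (u2 (tz, qz)))
        as [t [Ht Et]].
      * intro t; apply (continuous_canonical_utility_comp u2 (fun y => y) h); auto.
        apply continuous_id.
      * exact Htg.
      * rewrite Hhg, Hhx, !retract_Z_id by assumption; lra.
      * destruct (Hh t Ht) as [A B].
        assert (Zt : inZ (t, h t)) by (unfold inZ; simpl; lra).
        rewrite retract_Z_id in Et by exact Zt.
        assert (Eq : (t, h t) = (tz, qz)) by (apply Hinj; auto; lra).
        injection Eq as Eq _; lra.
  (* Here [x] is itself on the boundary path: both utilities equal [s] at [x], while [u2] exceeds
     [u1] at the interior point [z]. *)
  - assert (Ex : exists r, r <= 1 /\ boundary_path r = (tx, qx)).
    { destruct (Rle_dec tx 0).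
      - exists qx; rewrite boundary_path_nonneg by lra; split; [lra|f_equal; lra].
      - exists (- tx); rewrite boundary_path_nonpos by lra; split; [lra|f_equal; lra]. }
    destruct Ex as [r [Hr Er]].
    assert (s = r) by (unfold s; rewrite <- Er; auto).
    assert (u2 (tx, qx) = r) by (rewrite <- Er; auto).
    lra.
Qed.

(** If [u1] strictly prefers [z], raise the quality of [x] to the [q] at which [u1] becomes
    indifferent to [z]. The raised point is still strictly below [z], so the indifference case
    applies to it, and [u2] ranks [x] below the raised point. *)
Lemma utility_lt_of_lower_utility_le (u1 u2 : pt -> R) (x z : pt) :
  canonical_utility u1 -> canonical_utility u2 -> jointly_injective u1 u2 ->
  u1 (1, 1) < u2 (1, 1) ->
  inZ x -> inZ z -> lt_pt x z -> u1 x <= u1 z -> u2 x < u2 z.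
Proof.
  intros H1 H2 Hinj Hlt Hx Hz Hxz Hle.
  destruct (Rle_lt_or_eq_dec _ _ Hle) as [Hl|E];
    [|apply (utility_lt_along_indifference u1); assumption].
  destruct x as [tx qx], z as [tz qz]; pose proof Hxz as [Htlt Hqlt]; simpl in Htlt, Hqlt.
  pose proof Hx as [Hx1 Hx2]; pose proof Hz as [Hz1 Hz2]; simpl in Hx1, Hx2, Hz1, Hz2.
  pose proof H1 as (Hmt & _); pose proof H2 as (_ & Hmq & _).
  destruct (IVT_segment (fun q => u1 (retract_Z (tx, q))) qx qz (u1 (tz, qz))) as [q [Hq Eq]].
  - intro q; apply (continuous_canonical_utility_comp u1 (fun _ => tx) (fun y => y)); auto;
      [apply continuous_const|apply continuous_id].
  - lra.
  - rewrite !retract_Z_id by (unfold inZ; simpl; lra).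
    specialize (Hmt tx tz qz); lra.
  - assert (Zq : inZ (tx, q)) by (unfold inZ; simpl; lra).
    rewrite retract_Z_id in Eq by exact Zq.
    assert (qx <> q) by (intros ->; lra).
    assert (q <> qz) by (intros ->; specialize (Hmt tx tz qz); lra).
    assert (u2 (tx, q) < u2 (tz, qz)).
    { apply (utility_lt_along_indifference u1); auto; split; simpl; lra. }
    specialize (Hmq tx qx q); lra.
Qed.

(** * The order of a rich single-crossing domain *)

Definition utility_assignment (D : pref -> Prop) (U : pref -> pt -> R) : Prop :=
  forall Rl, D Rl -> canonical_utility (U Rl) /\ represents Rl (U Rl).

Lemma rich_utility_assignment (D : pref -> Prop) :
  rich_single_crossing D -> exists U, utility_assignment D U.
Proof.
  intros [HD _].
  exists (fun Rl => epsilon (inhabits (fun _ => 0))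
                      (fun u => canonical_utility u /\ represents Rl u)).
  intros Rl H; apply epsilon_spec, classical_canonical_utility, HD, H.
Qed.

Lemma represents_indiff (Rl : pref) (u : pt -> R) (x y : pt) :
  represents Rl u -> inZ x -> inZ y -> (indiff Rl x y <-> u x = u y).
Proof.
  intros Hr Hx Hy; unfold indiff; rewrite (Hr x y), (Hr y x) by assumption; lra.
Qed.

Lemma inZ_11 : inZ (1, 1).
Proof. unfold inZ; simpl; lra. Qed.

Section Domain.

Context (D : pref -> Prop) (U : pref -> pt -> R).
Context (HD : rich_single_crossing D) (HU : utility_assignment D U).

Lemma domain_jointly_injective (R1 R2 : pref) :
  D R1 -> D R2 -> R1 <> R2 -> jointly_injective (U R1) (U R2).
Proof using HD HU.
  intros H1 H2 Hne x y Hx Hy E1 E2.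
  destruct HD as (_ & Hsc & _).
  destruct (HU R1 H1) as [_ P1], (HU R2 H2) as [_ P2].
  apply (Hsc R1 R2 H1 H2 Hne y y x y); auto;
    first [apply (represents_indiff R1 (U R1)) | apply (represents_indiff R2 (U R2))]; auto.
Qed.

Lemma domain_type_inj (R1 R2 : pref) :
  D R1 -> D R2 -> U R1 (1, 1) = U R2 (1, 1) -> R1 = R2.
Proof using HD HU.
  intros H1 H2 E; apply NNPP; intro Hne.
  apply (interior_utility_neq (U R1) (U R2) 1 1); try lra.
  - apply HU, H1.
  - apply HU, H2.
  - apply domain_jointly_injective; assumption.
  - exact inZ_11.
Qed.

Lemma domain_utility_lt (R1 R2 : pref) (x z : pt) :
  D R1 -> D R2 -> U R1 (1, 1) < U R2 (1, 1) ->
  inZ x -> inZ z -> lt_pt x z -> U R1 x <= U R1 z -> U R2 x < U R2 z.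
Proof using HD HU.
  intros H1 H2 Hlt; apply utility_lt_of_lower_utility_le; try assumption.
  - apply HU, H1.
  - apply HU, H2.
  - apply domain_jointly_injective; try assumption; intros ->; lra.
Qed.

Lemma domain_type_range (Rl : pref) : D Rl -> -1 < U Rl (1, 1) < 1.
Proof using HU.
  intro H; apply canonical_utility_bounds_strict; [apply HU, H|exact inZ_11|lra|lra].
Qed.

Lemma boundary_path_lt_11 (s : R) : -1 < s < 1 -> lt_pt (boundary_path s) (1, 1).
Proof.
  intro H; unfold lt_pt, boundary_path; simpl; split; apply Rmax_lub_lt; lra.
Qed.

(** A larger utility of [(1, 1)] means more willingness to move up, which yields the inclusion of
    contour sets. Conversely, were the types reversed, the path point that [R2] finds indifferent to
    [(1, 1)] would be strictly worse than [(1, 1)] for [R1], against the inclusion. *)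
Lemma prec_iff_type_lt (R1 R2 : pref) :
  D R1 -> D R2 -> (prec R1 R2 <-> U R1 (1, 1) < U R2 (1, 1)).
Proof using HD HU.
  intros H1 H2; split.
  - intros [Hne Hsub].
    destruct (Rtotal_order (U R1 (1, 1)) (U R2 (1, 1))) as [|[E|Hgt]]; [assumption| |].
    + exfalso; apply Hne, domain_type_inj; assumption.
    + exfalso.
      pose proof (domain_type_range R2 H2) as Hr.
      set (x := boundary_path (U R2 (1, 1))).
      assert (Hx : inZ x) by (apply boundary_path_inZ; lra).
      assert (Hlt : lt_pt x (1, 1)) by (apply boundary_path_lt_11, Hr).
      assert (E : U R2 x = U R2 (1, 1)).
      { destruct (HU R2 H2) as [[_ [_ [Hp _]]] _]; apply Hp; lra. }
      assert (U R1 x < U R1 (1, 1)).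
      { apply (domain_utility_lt R2); auto using inZ_11; lra. }
      assert (HR1 : R1 x (1, 1)).
      { apply Hsub; auto using inZ_11; [right; exact Hlt|].
        apply (proj2 (HU R2 H2)); auto using inZ_11; lra. }
      apply (proj2 (HU R1 H1)) in HR1; auto using inZ_11; lra.
  - intro Hlt; split; [intros ->; lra|].
    intros z x Hz Hx Hle H.
    apply (proj2 (HU R2 H2)) in H; auto.
    apply (proj2 (HU R1 H1)); auto.
    destruct Hle as [->|Hxz]; [lra|].
    destruct (Rle_dec (U R1 z) (U R1 x)) as [|Hn]; [assumption|].
    assert (U R2 x < U R2 z); [|lra].
    apply (domain_utility_lt R1); auto; lra.
Qed.

(** Richness supplies a member indifferent between the path point of parameter [a] and [(1, 1)];
    normalisation on the path makes its type [a]. *)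
Lemma domain_type_surj : exists ty : R -> pref,
  forall a, -1 < a < 1 -> D (ty a) /\ U (ty a) (1, 1) = a.
Proof using HD HU.
  exists (fun a => epsilon (inhabits (fun _ _ => True)) (fun Rl => D Rl /\ U Rl (1, 1) = a)).
  intros a Ha; apply epsilon_spec.
  assert (Hx : inZ (boundary_path a)) by (apply boundary_path_inZ; lra).
  destruct HD as (_ & _ & Hrich).
  destruct (Hrich (boundary_path a) (1, 1)) as [Rl [HRl E]];
    [exact Hx|exact inZ_11|apply boundary_path_lt_11, Ha|].
  exists Rl; split; [exact HRl|].
  destruct (HU Rl HRl) as [[_ [_ [Hp _]]] Hr].
  apply (represents_indiff _ (U Rl)) in E; auto using inZ_11.
  rewrite Hp in E by lra; symmetry; exact E.
Qed.

Lemma monotone_seq_order_cvg (ty : R -> pref) (s : nat -> R) (x : R) :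
  (forall a, -1 < a < 1 -> D (ty a) /\ U (ty a) (1, 1) = a) ->
  -1 < x < 1 -> (forall n, -1 < s n < 1) -> is_lim_seq s x ->
  order_cvg D (fun n => ty (s n)) (ty x).
Proof using HD HU.
  intros Hty Hx Hs Hlim; split; intros b Hb Hp.
  - apply prec_iff_type_lt in Hp; [|exact Hb|apply Hty, Hx].
    rewrite (proj2 (Hty x Hx)) in Hp.
    destruct (proj2 (is_lim_seq_spec s x) Hlim (mkposreal _ (proj2 (Rlt_0_minus _ _) Hp))) as [N HN].
    exists N; intros n Hn; specialize (HN n Hn); simpl in HN; apply Rabs_def2 in HN.
    apply prec_iff_type_lt; [exact Hb|apply Hty, Hs|].
    rewrite (proj2 (Hty _ (Hs n))); lra.
  - apply prec_iff_type_lt in Hp; [|apply Hty, Hx|exact Hb].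
    rewrite (proj2 (Hty x Hx)) in Hp.
    destruct (proj2 (is_lim_seq_spec s x) Hlim (mkposreal _ (proj2 (Rlt_0_minus _ _) Hp))) as [N HN].
    exists N; intros n Hn; specialize (HN n Hn); simpl in HN; apply Rabs_def2 in HN.
    apply prec_iff_type_lt; [apply Hty, Hs|exact Hb|].
    rewrite (proj2 (Hty _ (Hs n))); lra.
Qed.

Lemma precsim_type (ty : R -> pref) (a b : R) :
  (forall a, -1 < a < 1 -> D (ty a) /\ U (ty a) (1, 1) = a) ->
  -1 < a < 1 -> -1 < b < 1 -> a <= b -> precsim (ty a) (ty b).
Proof using HD HU.
  intros Hty Ha Hb Hab; destruct (Req_dec a b) as [->|]; [left; reflexivity|right].
  apply prec_iff_type_lt; [apply Hty, Ha|apply Hty, Hb|].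
  rewrite (proj2 (Hty a Ha)), (proj2 (Hty b Hb)); lra.
Qed.

(** Limits preserve only weak coordinatewise inequalities. On one indifference set these suffice: if
    exactly one coordinate differed, strict monotonicity would separate the utilities. *)
Lemma indiff_weak_order (u : pt -> R) (x y : pt) :
  canonical_utility u -> inZ x -> inZ y -> fst x <= fst y -> snd x <= snd y -> u x = u y ->
  le_pt x y.
Proof.
  intros (Ht & Hq & _) Hx Hy Hle1 Hle2 E.
  destruct x as [tx qx], y as [ty qy]; destruct Hx, Hy; simpl in *.
  destruct (Req_dec tx ty) as [->|Hnt], (Req_dec qx qy) as [->|Hnq].
  - left; reflexivity.
  - specialize (Hq ty qx qy); lra.
  - specialize (Ht tx ty qy); lra.
  - right; split; simpl; lra.
Qed.

(** An upward move that leaves type [Rx] indifferent is weakly bad for lower types and weakly good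
    for higher ones: a lower type gaining from it would make [Rx] strictly gain. *)
Lemma domain_indiff_jump (Rx Ra : pref) (p q : pt) :
  D Rx -> D Ra -> inZ p -> inZ q -> le_pt p q -> U Rx p = U Rx q ->
  (U Ra (1, 1) <= U Rx (1, 1) -> U Ra q <= U Ra p) /\
  (U Rx (1, 1) <= U Ra (1, 1) -> U Ra p <= U Ra q).
Proof using HD HU.
  intros Hx Ha Hp Hq [->|Hlt] E; [split; lra|].
  split; intro H.
  - destruct (Req_dec (U Ra (1, 1)) (U Rx (1, 1))) as [Eq|].
    + apply domain_type_inj in Eq; auto; subst Rx; lra.
    + destruct (Rle_dec (U Ra q) (U Ra p)) as [|Hn]; [assumption|].
      assert (U Rx p < U Rx q); [|lra].
      apply (domain_utility_lt Ra); auto; lra.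
  - destruct (Req_dec (U Rx (1, 1)) (U Ra (1, 1))) as [Eq|].
    + apply domain_type_inj in Eq; auto; subst Rx; lra.
    + apply Rlt_le, (domain_utility_lt Rx); auto; lra.
Qed.

Lemma inZ_closed : closed inZ.
Proof.
  apply closed_and; [|apply closed_and].
  - apply (closed_comp fst (fun y => 0 <= y)); [|apply closed_ge].
    intros [a b]; apply continuous_fst.
  - apply (closed_comp snd (fun y => 0 <= y)); [|apply closed_ge].
    intros [a b]; apply continuous_snd.
  - apply (closed_comp snd (fun y => y <= 1)); [|apply closed_le].
    intros [a b]; apply continuous_snd.
Qed.

(** * Local-to-global incentive compatibility *)

Section Mechanism.

Context (F : pref -> pt) (ty : R -> pref).
Context (HF : forall Rl, D Rl -> inZ (F Rl)).
Context (Hmono : monotone_mech D F) (Hcont : VF_continuous D F).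
Context (Hty : forall a, -1 < a < 1 -> D (ty a) /\ U (ty a) (1, 1) = a).

Lemma mech_limit (s : nat -> R) (x : R) :
  -1 < x < 1 -> (forall n, -1 < s n < 1) -> is_lim_seq s x ->
  (forall n, s n <= s (S n)) \/ (forall n, s (S n) <= s n) ->
  exists l, inZ l /\ U (ty x) l = U (ty x) (F (ty x)) /\
    is_lim_seq (fun n => fst (F (ty (s n)))) (fst l) /\
    is_lim_seq (fun n => snd (F (ty (s n)))) (snd l) /\
    forall Ra, D Ra -> is_lim_seq (fun n => U Ra (F (ty (s n)))) (U Ra l).
Proof using All.
  intros Hx Hs Hlim Hsm.
  assert (HDs : forall n, D (ty (s n))) by (intro n; apply Hty, Hs).
  destruct (Hcont (ty x) (fun n => ty (s n))) as [l [Hl Hind]].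
  - apply Hty, Hx.
  - exact HDs.
  - destruct Hsm as [H|H]; [left|right]; intro n; apply precsim_type; auto.
  - apply monotone_seq_order_cvg; assumption.
  - assert (Zl : inZ l).
    { apply (closed_filterlim (F := eventually) _ inZ l Hl); [|apply inZ_closed].
      intro n; apply HF, HDs. }
    exists l; split; [exact Zl|split; [|split; [|split]]].
    + apply (represents_indiff (ty x)); auto; [apply HU, Hty, Hx|apply HF, Hty, Hx].
    + destruct l as [lt lq]; eapply filterlim_comp; [exact Hl|apply continuous_fst].
    + destruct l as [lt lq]; eapply filterlim_comp; [exact Hl|apply continuous_snd].
    + intros Ra Ha; destruct (HU Ra Ha) as [[_ [_ [_ Hc]]] _].
      (* Continuity of [U Ra] is available only through the retraction, which fixes the outcomes and
         their limit. *)
      apply (is_lim_seq_ext (fun n => U Ra (retract_Z (F (ty (s n)))))).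
      { intro n; rewrite retract_Z_id; [reflexivity|apply HF, HDs]. }
      rewrite <- (retract_Z_id l Zl).
      exact (filterlim_comp _ _ _ _ _ _ _ _ Hl (Hc l)).
Qed.

Lemma mech_weak_mono (a b : R) :
  -1 < a < 1 -> -1 < b < 1 -> a <= b ->
  fst (F (ty a)) <= fst (F (ty b)) /\ snd (F (ty a)) <= snd (F (ty b)).
Proof using All.
  intros Ha Hb Hab; destruct (precsim_type ty a b Hty Ha Hb Hab) as [->|H]; [lra|].
  apply Hmono in H; [|apply Hty, Ha|apply Hty, Hb].
  destruct H as [->|[H1 H2]]; lra.
Qed.

(** By monotonicity the limit of outcomes from the left lies below [F (ty x)], and by continuity of
    [V^F] type [x] is indifferent between the two. Any jump at [x] is thus an upward move along an
    indifference set of type [x], which types below and above [x] value oppositely. *)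
Lemma mech_left_limit (Ra : pref) (s : nat -> R) (x : R) :
  D Ra -> -1 < x < 1 -> (forall n, -1 < s n < 1) -> is_lim_seq s x ->
  (forall n, s n <= s (S n)) ->
  exists L : R, is_lim_seq (fun n => U Ra (F (ty (s n)))) L /\
    (U Ra (1, 1) <= x -> U Ra (F (ty x)) <= L) /\
    (x <= U Ra (1, 1) -> L <= U Ra (F (ty x))).
Proof using All.
  intros Ha Hx Hs Hlim Hinc.
  destruct (mech_limit s x Hx Hs Hlim (or_introl Hinc)) as (l & Zl & El & L1 & L2 & LU).
  assert (Hle : forall n, s n <= x).
  { intro n; exact (is_lim_seq_incr_compare s x Hlim Hinc n). }
  destruct (Hty x Hx) as [Dx Tx].
  exists (U Ra l); split; [apply LU, Ha|].
  assert (Hjump : le_pt l (F (ty x))).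
  { apply (indiff_weak_order (U (ty x))); auto; [apply HU, Dx| |].
    - refine (is_lim_seq_le _ _ _ _ _ L1 (is_lim_seq_const _)).
      intro n; apply mech_weak_mono; auto.
    - refine (is_lim_seq_le _ _ _ _ _ L2 (is_lim_seq_const _)).
      intro n; apply mech_weak_mono; auto. }
  pose proof (domain_indiff_jump (ty x) Ra _ _ Dx Ha Zl (HF _ Dx) Hjump El) as Hj.
  rewrite Tx in Hj; exact Hj.
Qed.

(** Mirror image of [mech_left_limit]: the limit now lies above [F (ty x)], so both inequalities for
    [L] are reversed. *)
Lemma mech_right_limit (Ra : pref) (s : nat -> R) (x : R) :
  D Ra -> -1 < x < 1 -> (forall n, -1 < s n < 1) -> is_lim_seq s x ->
  (forall n, s (S n) <= s n) ->
  exists L : R, is_lim_seq (fun n => U Ra (F (ty (s n)))) L /\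
    (U Ra (1, 1) <= x -> L <= U Ra (F (ty x))) /\
    (x <= U Ra (1, 1) -> U Ra (F (ty x)) <= L).
Proof using All.
  intros Ha Hx Hs Hlim Hdec.
  destruct (mech_limit s x Hx Hs Hlim (or_intror Hdec)) as (l & Zl & El & L1 & L2 & LU).
  assert (Hle : forall n, x <= s n).
  { intro n; exact (is_lim_seq_decr_compare s x Hlim Hdec n). }
  destruct (Hty x Hx) as [Dx Tx].
  exists (U Ra l); split; [apply LU, Ha|].
  assert (Hjump : le_pt (F (ty x)) l).
  { apply (indiff_weak_order (U (ty x))); auto; [apply HU, Dx| |].
    - refine (is_lim_seq_le _ _ _ _ _ (is_lim_seq_const _) L1).
      intro n; apply mech_weak_mono; auto.
    - refine (is_lim_seq_le _ _ _ _ _ (is_lim_seq_const _) L2).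
      intro n; apply mech_weak_mono; auto. }
  pose proof (domain_indiff_jump (ty x) Ra _ _ Dx Ha (HF _ Dx) Zl Hjump (eq_sym El)) as Hj.
  rewrite Tx in Hj; exact Hj.
Qed.

Lemma truthful_utility_ge (a b : R) :
  countable_set (range_of D F) -> -1 < a < 1 -> -1 < b < 1 ->
  U (ty a) (F (ty b)) <= U (ty a) (F (ty a)).
Proof using All.
  intros [k Hk] Ha Hb.
  destruct (Hty a Ha) as [Da Ta].
  set (g := fun x => U (ty a) (F (ty x))).
  (* Choosing one type per attained value and numbering its outcome by [k] would inject an interval
     into the natural numbers. *)
  assert (Hno : forall v1 v2, v1 < v2 ->
            ~ (forall v, v1 < v < v2 -> exists x, -1 < x < 1 /\ g x = v)).
  { intros v1 v2 Hv Hatt.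
    set (pre := fun v => epsilon (inhabits 0) (fun x => -1 < x < 1 /\ g x = v)).
    assert (Hpre : forall v, v1 < v < v2 -> -1 < pre v < 1 /\ g (pre v) = v).
    { intros v Hvv; exact (epsilon_spec (inhabits 0) _ (Hatt v Hvv)). }
    apply (interval_uncountable (fun v => k (F (ty (pre v)))) v1 v2 Hv).
    intros x y Hx Hy E.
    destruct (Hpre x Hx) as [X1 X2]; destruct (Hpre y Hy) as [Y1 Y2].
    rewrite <- X2, <- Y2; unfold g; f_equal; apply Hk; [| |exact E].
    - exists (ty (pre x)); split; [apply Hty, X1|reflexivity].
    - exists (ty (pre y)); split; [apply Hty, Y1|reflexivity]. }
  destruct (Rle_dec (g b) (g a)) as [|Hn]; [assumption|exfalso].
  destruct (Rtotal_order a b) as [Hab|[->|Hba]]; [|lra|].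
  - apply (Hno (g a) (g b)); [lra|]; intros v Hv.
    destruct (intermediate_value_down_jumps g a b Hab) with (v := v) as [c [Hc Ec]];
      [| |exact Hv|exists c; split; [lra|exact Ec]].
    + intros w s c Hs Hinc Hc Hlim Hle.
      destruct (mech_left_limit (ty a) s c Da) as [L [HL [H1 _]]]; auto;
        [lra|intro n; specialize (Hs n); lra|].
      apply Rle_trans with L; [apply H1; lra|].
      exact (is_lim_seq_le _ _ _ _ Hle HL (is_lim_seq_const w)).
    + intros w s c Hs Hdec Hc Hlim Hle.
      destruct (mech_right_limit (ty a) s c Da) as [L [HL [H1 _]]]; auto;
        [lra|intro n; specialize (Hs n); lra|].
      apply Rle_trans with L; [|apply H1; lra].
      exact (is_lim_seq_le _ _ _ _ Hle (is_lim_seq_const w) HL).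
  - apply (Hno (g a) (g b)); [lra|]; intros v Hv.
    (* To the left of [a], jumps of [g] go up as the type increases towards [a], so the intermediate
       value lemma is applied to [- g]. *)
    destruct (intermediate_value_down_jumps (fun x => - g x) b a Hba) with (v := - v)
      as [c [Hc Ec]]; [| |lra|exists c; split; lra].
    + intros w s c Hs Hinc Hc Hlim Hle.
      destruct (mech_left_limit (ty a) s c Da) as [L [HL [_ H1]]]; auto;
        [lra|intro n; specialize (Hs n); lra|].
      apply Rle_trans with (- L); [apply Ropp_le_contravar, H1; lra|].
      exact (is_lim_seq_le _ _ _ _ Hle (proj1 (is_lim_seq_opp _ _) HL) (is_lim_seq_const w)).
    + intros w s c Hs Hdec Hc Hlim Hle.
      destruct (mech_right_limit (ty a) s c Da) as [L [HL [_ H1]]]; auto;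
        [lra|intro n; specialize (Hs n); lra|].
      apply Rle_trans with (- L); [|apply Ropp_le_contravar, H1; lra].
      exact (is_lim_seq_le _ _ _ _ Hle (is_lim_seq_const w) (proj1 (is_lim_seq_opp _ _) HL)).
Qed.

End Mechanism.

End Domain.

Theorem mainTheorem14 (D : pref -> Prop) (F : pref -> pt) :
  rich_single_crossing D ->
  (forall Rl, D Rl -> inZ (F Rl)) ->
  monotone_mech D F ->
  VF_continuous D F ->
  countable_set (range_of D F) ->
  closed_in_Z (range_of D F) ->
  finitely_many_limit_points (range_of D F) ->
  strategy_proof D F.
Proof.
  intros HD HF Hmono Hcont Hcount _ _ R1 R2 H1 H2.
  destruct (rich_utility_assignment D HD) as [U HU].
  destruct (domain_type_surj D U HD HU) as [ty Hty].
  pose proof (domain_type_range D U HU R1 H1) as T1.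
  pose proof (domain_type_range D U HU R2 H2) as T2.
  (* Since types determine members, every preference is recovered from its type and the inequality
     between types covers the whole domain. *)
  assert (Hinv : forall Rl, D Rl -> -1 < U Rl (1, 1) < 1 -> ty (U Rl (1, 1)) = Rl).
  { intros Rl Hl T; destruct (Hty _ T) as [A B].
    apply (domain_type_inj D U HD HU); assumption. }
  pose proof (truthful_utility_ge D U HD HU F ty HF Hmono Hcont Hty _ _ Hcount T1 T2) as H.
  rewrite !Hinv in H by assumption.
  apply (proj2 (HU R1 H1)); auto.
Qed.
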